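(* Let $F_j : \mathbb{R}^m \to \mathbb{R}^m$, $j = 0,\ldots,J-1$, be arbitrary maps, let $P_j$, $W$, $\Lambda$, $\bar{x}$, $\mathbf{F}$ and $\mathbf{G}^P$ be as defined in the context, and let $\mathbf{I}$ be the identity map on $(\mathbb{R}^m)^J$. Then $\mathbf{v}^* \in (\mathbb{R}^m)^J$ satisfies the PMACE equation $\mathbf{F}(\mathbf{v}^* ) = \mathbf{G}^P(\mathbf{v}^* )$ if and only if $\mathbf{v}^*$ is a fixed point of $\mathbf{T} = (2\mathbf{G}^P - \mathbf{I})(2\mathbf{F} - \mathbf{I})$, that is, $$(2\mathbf{G}^P - \mathbf{I})(2\mathbf{F} - \mathbf{I})(\mathbf{v}^* ) = \mathbf{v}^* .$$
   Context: Setting. $J \ge 1$; $P_j$ ($j=0,\ldots,J-1$) is a real $m \times n$ matrix with orthonormal rows, so $P_j P_j^T = I$. $W$ is a (symmetric) positive definite $m \times m$ matrix, and $\Lambda = \sum_{j=0}^{J-1} P_j^T W P_j$ is assumed invertible. For $\mathbf{v} = [v_0,\ldots,v_{J-1}]$ with each $v_j \in \mathbb{R}^m$, define $$\bar{x}(\mathbf{v}) = \Lambda^{-1}\sum_{j=0}^{J-1} P_j^T W v_j \in \mathbb{R}^n, \qquad \mathbf{G}^P(\mathbf{v}) = [P_0 \bar{x}(\mathbf{v}), \ldots, P_{J-1}\bar{x}(\mathbf{v})].$$ Given maps $F_j : \mathbb{R}^m \to \mathbb{R}^m$ (called agents), define $\mathbf{F}(\mathbf{v}) = [F_0(v_0),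 \ldots, F_{J-1}(v_{J-1})]$. Products of operators denote composition. (Complex images are regarded as real vectors by stacking real and imaginary parts.) *)

(* Defs.v *)
From HB Require Import structures.
From mathcomp Require Import all_boot all_order all_algebra.
From mathcomp Require Import reals.

Set Implicit Arguments.
Unset Strict Implicit.
Unset Printing Implicit Defensive.

Import Order.TTheory GRing.Theory Num.Theory.
Local Open Scope ring_scope.

Section PMACE.
Variables (R : realType) (J m n : nat).

(* The space (R^m)^J, with the pointwise vector space structure of {ffun _}. *)
Definition stack := {ffun 'I_J -> 'cV[R]_m}.

Definition sym_posdef (W : 'M[R]_m) : Prop :=
  W^T = W /\ (forall x : 'cV[R]_m, x != 0 -> 0 < (x^T *m W *m x) ord0 ord0).

Definition orthonormal_rows (A : 'M[R]_(m, n)) : Prop := A *m A^T = 1%:M.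

Definition Lambda (P : 'I_J -> 'M[R]_(m, n)) (W : 'M[R]_m) : 'M[R]_n :=
  \sum_(j < J) (P j)^T *m W *m P j.

(* invmx A is the inverse of A only when A \in unitmx, so xbar has its
   intended meaning under the hypothesis that Lambda P W is invertible. *)
Definition xbar (P : 'I_J -> 'M[R]_(m, n)) (W : 'M[R]_m) (v : stack) :
    'cV[R]_n :=
  invmx (Lambda P W) *m \sum_(j < J) (P j)^T *m W *m v j.

Definition GP (P : 'I_J -> 'M[R]_(m, n)) (W : 'M[R]_m) (v : stack) : stack :=
  [ffun j => P j *m xbar P W v].

Definition agents (F : 'I_J -> 'cV[R]_m -> 'cV[R]_m) (v : stack) : stack :=
  [ffun j => F j (v j)].

(* The operator 2 H - I on (R^m)^J, for a possibly nonlinear map H. *)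
Definition reflector (H : stack -> stack) (v : stack) : stack :=
  2 *: H v - v.

End PMACE.

(* Main.v *)
(** The consensus operator [GP] is linear, and since [Lambda^-1] cancels the sum
    [Lambda] of the [P_j^T W P_j], it is idempotent. With [f = F(v)] the
    fixed-point equation reads [GP (2 f - v) = f]. It follows from [GP v = f] by
    idempotence; conversely it puts [f] in the range of [GP], so [GP f = f], and
    linearity turns it into [2 f - GP v = f]. *)

From HB Require Import structures.
Require Import Defs.
From mathcomp Require Import all_boot all_order all_algebra.
From mathcomp Require Import reals.
Import GRing.Theory Num.Theory.
Local Open Scope ring_scope.

Lemma idempotent_reflection_fixed (K : numFieldType) (V : lmodType K)
    (G : {linear V -> V}) (G_idem : forall u, G (G u) = G u) (f v : V) :
  f = G v <-> 2 *: G (2 *: f - v) - (2 *: f - v) = v.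
Proof.
have two_sub (x : V) : 2 *: x - x = x by rewrite scaler_nat mulr2n addrK.
split=> [-> | fixv].
  by rewrite linearB linearZ /= G_idem two_sub opprB addrC subrK.
have Gf : G (2 *: f - v) = f.
  have two_neq0 : (2 : K) != 0 by rewrite pnatr_eq0.
  (* Adding [2 *: f - v] to both sides of [fixv] gives twice the goal. *)
  apply: (scalerI two_neq0).
  by rewrite -[LHS](subrK (2 *: f - v)) fixv addrC subrK.
have Gff : G f = f by rewrite -{1}Gf G_idem.
move/eqP: Gf; rewrite linearB linearZ /= Gff subr_eq scaler_nat mulr2n.
by move/eqP/addrI.
Qed.

Section ConsensusOperator.
Context {R : realType} {J m n : nat}.
Variables (P : 'I_J -> 'M[R]_(m, n)) (W : 'M[R]_m).

Lemma xbar_linear : linear (xbar P W).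
Proof.
move=> a u v; rewrite /xbar scalemxAr -mulmxDr scaler_sumr -big_split /=.
by congr (_ *m _); apply: eq_bigr => j _; rewrite !ffunE mulmxDr scalemxAr.
Qed.

Lemma GP_linear : linear (GP P W).
Proof.
by move=> a u v; apply/ffunP=> j; rewrite !ffunE xbar_linear mulmxDr -scalemxAr.
Qed.

(** Lets [GP P W] serve as the linear map [G] of [idempotent_reflection_fixed]. *)
HB.instance Definition _ :=
  GRing.isLinear.Build R (stack R J m) (stack R J m) _ (GP P W) GP_linear.

Lemma GP_idempotent (Lambda_inv : Lambda P W \in unitmx) (v : stack R J m) :
  GP P W (GP P W v) = GP P W v.
Proof.
suff xbarK : xbar P W (GP P W v) = xbar P W v.
  by apply/ffunP=> j; rewrite !ffunE xbarK.
rewrite {1}/xbar.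
(* Reassociated, the sum factors as [Lambda P W *m xbar P W v], and [invmx (Lambda P W)] cancels. *)
under eq_bigr => j _ do rewrite ffunE mulmxA.
by rewrite -mulmx_suml mulKmx.
Qed.

End ConsensusOperator.

Theorem mainTheorem4 (R : realType) (J m n : nat) (J_ge1 : (1 <= J)%N)
    (P : 'I_J -> 'M[R]_(m, n)) (P_orth : forall j, orthonormal_rows (P j))
    (W : 'M[R]_m) (W_posdef : sym_posdef W)
    (Lambda_inv : Lambda P W \in unitmx)
    (F : 'I_J -> 'cV[R]_m -> 'cV[R]_m) (v : stack R J m) :
  agents F v = GP P W v <->
  (reflector (GP P W) \o reflector (agents F)) v = v.
Proof.
(* Here [f] is [agents F v]; the composed reflectors unfold by conversion. *)
exact: idempotent_reflection_fixed (GP_idempotent P W Lambda_inv) _ _.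
Qed.
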